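(* Let $n$ be a positive integer. If $q$ is prime, then the map $(S,\mathcal{U})\mapsto G_n(S,\mathcal{U})$ is a bijection from the set of pairs $(S,\mathcal{U})$, where $S\subset[[n]]$ is a $k$-element antichain with respect to $\prec_{[[n]]}$ (for some $k\geq 0$) and $\mathcal{U}\in\widetilde{\mathcal{V}}_k(\mathbb{F}_q)$ with the same $k=|S|$, to the set of supernormal subgroups of $U_n(q)$. Consequently, the number of supernormal subgroups of $U_n(q)$, which is also the number of two-sided ideals of $\mathfrak{n}_n(q)$, is $$\sum_{k=0}^{n-1}N(n,k+1)\,\bigl|\widetilde{\mathcal{V}}_k(\mathbb{F}_q)\bigr|=\sum_{0\leq i\leq j\leq k<n}\frac{(-1)^{k-j}}{n}\binom{n}{k+1}\binom{n}{k}\binom{k}{j}\binom{j}{i}_q.$$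
   Context: $\mathfrak{n}_n(q)$ is the nilpotent $\mathbb{F}_q$-algebra of strictly upper triangular $n\times n$ matrices over $\mathbb{F}_q$, and $U_n(q)=\{1+X:X\in\mathfrak{n}_n(q)\}$ is the group of unipotent upper triangular matrices. The superclass of $g\in U_n(q)$ is $\{1+x(g-1)y:x,y\in U_n(q)\}$. A subgroup of $U_n(q)$ is supernormal if it is a union of superclasses. $[[n]]=\{(i,j):1\leq i<j\leq n\}$, partially ordered by $(j,k)\preceq_{[[n]]}(i,l)$ if and only if $i\leq j<k\leq l$; $\prec_{[[n]]}$ is the corresponding strict order. An antichain is a subset in which no two distinct elements are comparable. $\widetilde{\mathcal{V}}_k(\mathbb{F}_q)$, for $k>0$, is the set of subspaces of $\mathbb{F}_q^k$ containing none of the standard basis vectors $e_1,\dots,e_k$; and $\widetilde{\mathcal{V}}_0(\mathbb{F}_q)=\{\{0\}\}$. For a $k$-element antichain $S\subset[[n]]$, enumerate its elements as $(i_1,j_1),\dots,(i_k,j_k)$ with $i_1<\dots<i_k$ (then $j_1<\dots<j_k$) and define the linear map $\varphi_S:\mathfrak{n}_n(q)\to\mathbb{F}_q^k$ by $\varphi_S(X)=(X_{i_1j_1},\dots,X_{i_kj_k})$ if $k>0$, and $\varphi_S(X)=0$ if $k=0$. For $\mathcal{U}\in\widetilde{\mathcal{V}}_k(\mathbb{F}_q)$ define $$G_n(S,\mathcal{U})=\{1+X\in U_n(q):\varphi_S(X)\in\mathcal{U}\text{ and }X_{ij}=0\text{ whenever there exists }(k',l')\in S\text{ with }(i,j)\prec_{[[n]]}(k',l')\}.$$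 $N(n,k+1)=\frac1n\binom{n}{k+1}\binom nk$ for $0\leq k<n$ (Narayana numbers, equal to $0$ for $k\ge n$), and $\binom{j}{i}_q$ is the $q$-binomial coefficient, i.e. the number of $i$-dimensional subspaces of $\mathbb{F}_q^j$. *)

(* Defs.v *)
From HB Require Import structures.
From mathcomp Require Import all_boot all_order all_fingroup all_algebra.
Import GRing.Theory.

Set Implicit Arguments.
Unset Strict Implicit.
Unset Printing Implicit Defensive.

Local Open Scope ring_scope.

(* Over a finite field a vector space has finitely many subspaces. *)
Section FiniteVspace.
Import VectorInternalTheory.
Variables (F : finFieldType) (vT : vectType F).
HB.instance Definition _ := [Countable of {vspace vT} by <:].
HB.instance Definition _ := [Finite of {vspace vT} by <:].
End FiniteVspace.

(* The size n >= 1 of the matrices is written m.+1, and F stands for the field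
   with q = #|F| elements. Rows and columns are numbered from 0 to m. *)

Section Poset.

Variable m : nat.
Implicit Types (a b : 'I_m.+1 * 'I_m.+1) (S : {set 'I_m.+1 * 'I_m.+1}).

Definition upper_pairs : {set 'I_m.+1 * 'I_m.+1} :=
  [set a : 'I_m.+1 * 'I_m.+1 | (a.1 < a.2)%N].

(* These two relations are only meant for elements of [upper_pairs]. *)
Definition prec_eq a b : bool := ((b.1 <= a.1) && (a.2 <= b.2))%N.

Definition prec a b : bool := (a != b) && prec_eq a b.

Definition antichain S : bool :=
  (S \subset upper_pairs) &&
  [forall a in S, forall b in S, (a != b) ==> ~~ prec_eq a b].

(* The elements (i_1, j_1), ..., (i_k, j_k) of S, by increasing i. *)
Definition enum_by_row S : seq ('I_m.+1 * 'I_m.+1) :=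
  sort (fun a b => (a.1 <= b.1)%N) (enum S).

End Poset.

Section Algebra.

Variables (F : finFieldType) (m : nat).

Definition strict_upper : {set 'M[F]_m.+1} :=
  [set X : 'M[F]_m.+1 |
     [forall i : 'I_m.+1, forall j : 'I_m.+1, (j <= i)%N ==> (X i j == 0)]].

(* Unipotent matrices are invertible, so all of them are elements of GL_n. *)
Definition unitri : {set {'GL_m.+1[F]}} :=
  [set g : {'GL_m.+1[F]} | GLval g - 1 \in strict_upper].

Definition superclass (g : {'GL_m.+1[F]}) : {set {'GL_m.+1[F]}} :=
  [set h : {'GL_m.+1[F]} | [exists x in unitri, exists y in unitri,
     GLval h == 1 + GLval x * (GLval g - 1) * GLval y]].

Definition superclasses : {set {set {'GL_m.+1[F]}}} :=
  [set superclass g | g in unitri].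

Definition supernormal_subgroups : {set {set {'GL_m.+1[F]}}} :=
  [set H : {set {'GL_m.+1[F]}} | [&& group_set H, H \subset unitri &
     [exists K : {set {set {'GL_m.+1[F]}}},
        (K \subset superclasses) && (H == cover K)]]].

(* Ideals of an algebra: they are required to be subspaces. *)
Definition two_sided_ideals : {set {vspace 'M[F]_m.+1}} :=
  [set I : {vspace 'M[F]_m.+1} |
     [forall Y, (Y \in I) ==> (Y \in strict_upper)] &&
     [forall X in strict_upper, forall Y,
        (Y \in I) ==> (X * Y \in I) && (Y * X \in I)]].

(* For k = 0 the condition is void and the only element is the zero space. *)
Definition Vtilde (k : nat) : {set {vspace 'rV[F]_k}} :=
  [set U : {vspace 'rV[F]_k} | [forall i, delta_mx 0 i \notin U]].

Definition phi (S : {set 'I_m.+1 * 'I_m.+1}) (X : 'M[F]_m.+1) : 'rV[F]_#|S| :=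
  \row_(r < #|S|) let a := nth (0, 0) (enum_by_row S) r in X a.1 a.2.

Definition Gn (S : {set 'I_m.+1 * 'I_m.+1}) (U : {vspace 'rV[F]_#|S|}) :
    {set {'GL_m.+1[F]}} :=
  [set g in unitri | let X : 'M[F]_m.+1 := GLval g - 1 in
     (phi S X \in U) &&
     [forall a in upper_pairs m,
        [exists b in S, prec a b] ==> (X a.1 a.2 == 0)]].

(* Pairs (S, U) with U a subspace of F ^ #|S|. *)
Definition pair_type : finType :=
  {S : {set 'I_m.+1 * 'I_m.+1} & {vspace 'rV[F]_#|S|}}.

Definition antichain_pairs : {set pair_type} :=
  [set SU : pair_type | antichain (tag SU) && (tagged SU \in Vtilde #|tag SU|)].

Definition Gmap (SU : pair_type) : {set {'GL_m.+1[F]}} := Gn (tagged SU).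

End Algebra.

(* N(n, k); as usual N(n, 0) = 0. *)
Definition narayana (n k : nat) : rat :=
  if k is k'.+1 then n%:R^-1 * 'C(n, k'.+1)%:R * 'C(n, k')%:R else 0.

Definition qbinom (F : finFieldType) (j i : nat) : nat :=
  #|[set U : {vspace 'rV[F]_j} | \dim U == i]|.

(* Main.v *)
From HB Require Import structures.
Require Import Defs.
From mathcomp Require Import all_boot all_order all_fingroup all_algebra.
From mathcomp Require Import zify ring.
Import GRing.Theory.

Set Implicit Arguments.
Unset Strict Implicit.
Unset Printing Implicit Defensive.

Local Open Scope ring_scope.

(** The bridge between groups and pairs is the set of two-sided ideals of the
    algebra of strictly upper triangular matrices.

    An ideal I gives the supernormal subgroup 1 + I. Conversely let H be
    supernormal and I = H - 1. If 1 + X and 1 + Y are in H, so is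
    h = 1 + (1 + X)^-1 Y, which lies in the superclass of 1 + Y, and therefore
    also (1 + X) h = 1 + X + Y. Thus I is additively closed, which for a
    prime field makes it a subspace; and (1 + A) X - X = A X shows that it is
    an ideal. This is [supernormal_ideal].

    Write e_a for the elementary matrix at position a. If X is in an ideal I
    and X has a nonzero entry at a, then multiplying X by elementary matrices
    shows that e_b is in I for every b strictly above a
    ([ideal_delta_above]). So, if S is the set of maximal positions among
    those a with e_a not in I, all elements of I vanish strictly below S, and
    I contains e_a for every a that is not below an element of S. Such an
    ideal is determined by S and by the image U of I under phi_S, and U
    contains no standard basis vector because e_s is not in I for s in S
    ([ideal_pattern], [ideal_Vtilde]). Conversely S is recovered from the
    ideal attached to a pair ([corners_pattern]), and so is U
    ([pattern_inj]).

    It remains to count. The antichains of size k lying in the first p rows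
    and the first q columns satisfy a Pascal-like recurrence, obtained by
    asking whether they meet the last row, the last column, or both
    ([card_boxed_antichains_rec]); its solution is a 2 x 2 determinant of
    binomial coefficients, which is a Narayana number when the box is the whole
    matrix. The subspaces that avoid the first t standard basis vectors are
    counted by t-fold finite differences of the total number of subspaces:
    those which contain one more basis vector are the subspaces of the quotient
    by its line ([card_avoiding_rec]). *)

(** * Counting antichains *)

Section AntichainCount.
Variable m : nat.
Implicit Types (a b : 'I_m.+1 * 'I_m.+1) (S : {set 'I_m.+1 * 'I_m.+1}).

Lemma antichainP S :
  reflect ((forall a, a \in S -> (a.1 < a.2)%N) /\
           (forall a b, a \in S -> b \in S -> prec_eq a b -> a = b))
          (antichain S).
Proof.
apply: (iffP andP) => [[/subsetP Sup /forall_inP anti]|[Sup anti]]; split.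
- by move=> a /Sup; rewrite inE.
- move=> a b aS bS ab; apply: contraTeq (ab) => neq_ab.
  by move/forall_inP: (anti a aS) => /(_ b bS); rewrite neq_ab.
- by apply/subsetP=> a /Sup; rewrite inE.
- apply/forall_inP=> a aS; apply/forall_inP=> b bS; apply/implyP.
  by apply: contra => /(anti a b aS bS) ->.
Qed.

Definition boxed_antichains p q k : {set {set 'I_m.+1 * 'I_m.+1}} :=
  [set S | [&& antichain S, #|S| == k & [forall a in S, (a.1 < p)%N && (a.2 < q)%N]]].

Lemma boxed_antichainsP p q k S :
  reflect [/\ antichain S, #|S| = k & forall a, a \in S -> (a.1 < p)%N && (a.2 < q)%N]
          (S \in boxed_antichains p q k).
Proof.
by rewrite inE; apply: (iffP and3P) => -[? /eqP ? /forall_inP ?]; split=> //; exact/eqP.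
Qed.

Lemma antichainD1 S a : antichain S -> antichain (S :\ a).
Proof.
case/antichainP=> Sup anti; apply/antichainP; split=> [b|b c].
  by case/setD1P=> _ /Sup.
by case/setD1P=> _ bS /setD1P[_ cS]; exact: anti.
Qed.

(** Inclusion-exclusion over the antichains that miss the last row p and those
    that miss the last column q. An antichain meeting both meets them in the
    same element, the corner (p, q): within the box an element of row p always
    lies below an element of column q. Removing this corner leaves an antichain of the
    smaller box. The bound p < q puts the corner above the diagonal. *)
Lemma card_boxed_antichains_rec p q k : (p < q <= m)%N ->
  (#|boxed_antichains p.+1 q.+1 k.+1| + #|boxed_antichains p q k.+1| =
   #|boxed_antichains p q.+1 k.+1| + #|boxed_antichains p.+1 q k.+1| +
   #|boxed_antichains p q k|)%N.
Proof.
case/andP=> ltpq leqm.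
pose c : 'I_m.+1 * 'I_m.+1 := (inord p, inord q).
have c1 : c.1 = p :> nat by rewrite inordK //; lia.
have c2 : c.2 = q :> nat by rewrite inordK.
have corner (x y p' q' : nat) :
    ~~ ((x < p') && (y < q'.+1))%N -> ((x < p'.+1) && (y < q'.+1))%N -> x = p'.
  by lia.
pose A := boxed_antichains p q.+1 k.+1; pose B := boxed_antichains p.+1 q k.+1.
pose C := [set c |: S | S in boxed_antichains p q k].
have cN p' q' k' S : (p' <= p)%N || (q' <= q)%N -> S \in boxed_antichains p' q' k' -> c \notin S.
  move=> h /boxed_antichainsP[_ _ box]; apply/negP=> /box.
  by rewrite c1 c2; lia.
have cardC : #|C| = #|boxed_antichains p q k|.
  apply: card_in_imset => S T SB TB eqST.
  rewrite -(setU1K (cN p q k S _ SB)) ?leqnn // eqST setU1K //.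
  by apply: (cN p q k) => //; rewrite leqnn.
have AB : A :&: B = boxed_antichains p q k.+1.
  apply/setP=> S; rewrite inE; apply/andP/boxed_antichainsP.
    case=> /boxed_antichainsP[aS cS bA] /boxed_antichainsP[_ _ bB]; split=> // a aS'.
    by have := bA a aS'; have := bB a aS'; lia.
  case=> aS cS bS; split; apply/boxed_antichainsP; split=> // a /bS; lia.
have ABC : (A :|: B) :&: C = set0.
  apply/setP=> S; rewrite in_setI in_setU in_set0; apply/negP=> /andP[SAB /imsetP[T _ eqS]].
  have: c \notin S.
    by case/orP: SAB => SAB; apply: cN SAB; rewrite leqnn ?orbT.
  by rewrite eqS setU11.
have U : boxed_antichains p.+1 q.+1 k.+1 = (A :|: B) :|: C.
  apply/setP=> S; rewrite !in_setU; apply/idP/idP.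
    move=> /boxed_antichainsP[aS cS box]; case/antichainP: (aS) => Sup anti.
    case SA : (S \in A) => //=; case SB : (S \in B) => //=.
    have [/forall_inP h|/forall_inPn[a aS' ha]] :=
      boolP [forall a in S, (a.1 < p)%N && (a.2 < q.+1)%N].
      by case/boxed_antichainsP: SA; split.
    have [/forall_inP h|/forall_inPn[b bS' hb]] :=
      boolP [forall a in S, (a.1 < p.+1)%N && (a.2 < q)%N].
      by case/boxed_antichainsP: SB; split.
    have a1 : a.1 = p :> nat by apply: (corner _ _ _ _ ha (box a aS')).
    have b2 : b.2 = q :> nat.
      apply: (corner _ b.1 _ p); last by rewrite andbC; exact: box bS'.
      by rewrite andbC.
    have eqab : a = b.
      apply: anti => //; rewrite /prec_eq a1 b2.
      by have := box a aS'; have := box b bS'; lia.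
    have eqac : a = c.
      by apply/eqP; rewrite -pair_eqE /= -!val_eqE /= c1 c2 a1 eqab b2 !eqxx.
    have cS' : c \in S by rewrite -eqac.
    apply/imsetP; exists (S :\ c); last by rewrite setD1K.
    apply/boxed_antichainsP; split; first exact: antichainD1.
      by apply/eqP; rewrite -eqSS -cS (cardsD1 c S) cS'.
    move=> d /setD1P[neq dS].
    have := box d dS => /andP[d1 d2].
    apply: contraT => h; case/negP: neq; apply/eqP.
    (* An element of S in the last row or column is comparable to the corner. *)
    have [e|e] : d.1 = p :> nat \/ d.2 = q :> nat by lia.
      by apply: anti => //; rewrite /prec_eq c1 c2; lia.
    by apply/esym/anti; rewrite // /prec_eq c1 c2; lia.
  move/orP=> [/orP[]|].
  - by case/boxed_antichainsP=> ? ? box; apply/boxed_antichainsP; split=> // a /box; lia.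
  - by case/boxed_antichainsP=> ? ? box; apply/boxed_antichainsP; split=> // a /box; lia.
  case/imsetP=> T TB ->; have cT : c \notin T.
    by apply: (cN p q k) => //; rewrite leqnn.
  case/boxed_antichainsP: TB => /antichainP[Tup anti] cardT box.
  apply/boxed_antichainsP; split.
  - apply/antichainP; split=> [a|a b].
      by case/setU1P=> [->|/Tup //]; rewrite c1 c2.
    case/setU1P=> [->|aT] /setU1P[->|bT] //; rewrite /prec_eq ?c1 ?c2.
    + by have := box b bT; lia.
    + by have := box a aT; lia.
    + exact: anti.
  - by rewrite cardsU1 cT cardT.
  - move=> a /setU1P[->|/box]; rewrite ?c1 ?c2; lia.
rewrite U cardsU ABC cards0 subn0 cardC -AB -/A -/B.
have := cardsUI A B; lia.
Qed.

Lemma card_boxed_antichains0 p q : #|boxed_antichains p q 0| = 1%N.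
Proof.
rewrite -[RHS](cards1 (set0 : {set 'I_m.+1 * 'I_m.+1})); apply: eq_card => S.
apply/boxed_antichainsP/set1P => [[_ /eqP + _]|->].
  by rewrite cards_eq0 => /eqP.
split=> [||a]; rewrite ?cards0 ?inE //.
by apply/antichainP; split=> [a|a b]; rewrite inE.
Qed.

Lemma boxed_antichains_no_row q k : boxed_antichains 0 q k.+1 = set0.
Proof.
apply/setP=> S; rewrite in_set0; apply/negP=> /boxed_antichainsP[_ cardS box].
by have /card_gt0P[a /box] : (0 < #|S|)%N by rewrite cardS.
Qed.

(** Above the diagonal, row q has no entry in the first q + 1 columns. *)
Lemma boxed_antichains_diag q k :
  boxed_antichains q.+1 q.+1 k = boxed_antichains q q.+1 k.
Proof.
apply/setP=> S; apply/boxed_antichainsP/boxed_antichainsP => -[aS cS box];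
  case/antichainP: (aS) => Sup _; split=> // a aS'.
  by have := Sup a aS'; have := box a aS'; lia.
by have := box a aS'; lia.
Qed.

(** The number is the determinant C(p,k+1) C(q,k+1) - C(p,k+2) C(q,k), as for
    pairs of non-crossing lattice paths. It satisfies the recurrence of
    [card_boxed_antichains_rec], and its values for p = q + 1 and p = q agree,
    as [boxed_antichains_diag] demands. *)
Lemma card_boxed_antichains p q k : (p <= q.+1 <= m.+1)%N ->
  (#|boxed_antichains p q.+1 k.+1| + 'C(p, k.+2) * 'C(q, k) =
   'C(p, k.+1) * 'C(q, k.+1))%N.
Proof.
case/andP=> lepq leqm; elim: q p k leqm lepq => [|q IHq] p k leqm.
  case: p => [|[|p]] // _; rewrite ?boxed_antichains_diag boxed_antichains_no_row;
    by rewrite cards0 (@bin_small 0 k.+1) // (@bin_small _ k.+2) // muln0.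
elim: p k => [|p IHp] k lepq.
  by rewrite boxed_antichains_no_row cards0 !(@bin_small 0).
have IH1 := IHp k (ltnW lepq).
have [ltpq|leqp] := ltnP p q.+1; last first.
  have {lepq leqp} eqp : p = q.+1 by lia.
  rewrite eqp in IH1 *; rewrite boxed_antichains_diag.
  rewrite (binS q.+1 k.+1) [X in (_ = X * _)%N]binS; lia.
have leqm' : (q < m.+1)%N by exact: ltnW.
have := @card_boxed_antichains_rec p q.+1 k; rewrite ltpq => /(_ leqm) rec.
have IH2 := IHq p k leqm' (ltnW ltpq); have IH3 := IHq p.+1 k leqm' ltpq.
(* One element: the last term of the recurrence counts the empty antichain. *)
case: k => [|k] in rec IH1 IH2 IH3 *.
  move: rec IH1 IH2 IH3; rewrite card_boxed_antichains0 !bin0 !bin1 (binS p 1) bin1; lia.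
have IH4 := IHq p k leqm' (ltnW ltpq).
move: rec IH1 IH2 IH3 IH4; rewrite !(binS p) !(binS q); lia.
Qed.

Lemma card_antichains k :
  (m.+1 * #|[set S : {set 'I_m.+1 * 'I_m.+1} | antichain S && (#|S| == k)]| =
   'C(m.+1, k.+1) * 'C(m.+1, k))%N.
Proof.
have -> : [set S : {set 'I_m.+1 * 'I_m.+1} | antichain S && (#|S| == k)] =
          boxed_antichains m.+1 m.+1 k.
  apply/setP=> S; rewrite inE; apply/andP/boxed_antichainsP => [[? /eqP ?]|[? /eqP ? _]] //.
  by split=> // a _; rewrite !ltn_ord.
case: k => [|k]; first by rewrite card_boxed_antichains0 bin1 bin0.
have := @card_boxed_antichains m.+1 m k; rewrite !leqnn => /(_ isT) H.
have h1 := mul_bin_diag m.+1 k.+1; have h2 := mul_bin_diag m.+1 k; rewrite /= in h1 h2.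
apply/eqP; rewrite -(eqn_add2r (m.+1 * ('C(m.+1, k.+2) * 'C(m, k)))) -mulnDr H; apply/eqP.
set a := 'C(m.+1, k.+2) in H h1 h2 *; set b := 'C(m.+1, k.+1) in H h1 h2 *.
have -> : (m.+1 * (b * 'C(m, k.+1)) = b * (m.+1 * 'C(m, k.+1)))%N by lia.
have -> : (m.+1 * (a * 'C(m, k)) = a * (m.+1 * 'C(m, k)))%N by lia.
rewrite h1 h2 -/a -/b; lia.
Qed.

(** The count of [card_antichains] vanishes for k > m. *)
Lemma card_antichain_le S : antichain S -> (#|S| <= m)%N.
Proof.
move=> aS; rewrite leqNgt; apply/negP=> ltmS.
have := card_antichains #|S|; rewrite (bin_small (n := m.+1) (m := #|S|.+1)) ?mul0n //.
move/eqP; rewrite muln_eq0 /= cards_eq0 => /eqP/setP/(_ S).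
by rewrite !inE aS eqxx.
Qed.

End AntichainCount.

(** * Counting subspaces that avoid the standard basis *)

(** Newton's formula for the t-fold finite difference: by Pascal's rule the right
    side obeys the recurrence of d. *)
Lemma iterated_difference (d : nat -> nat -> rat) :
  (forall t k, d t.+1 k = d t k.+1 - d t k) ->
  forall t k, d t k = \sum_(j < t.+1) (-1) ^+ (t - j) * 'C(t, j)%:R * d 0%N (k + j)%N.
Proof.
move=> rec; elim=> [|t IHt] k; first by rewrite big_ord1 addn0 !mul1r.
rewrite rec [LHS]addrC !IHt [X in - X]big_ord_recl [RHS]big_ord_recl /= opprD -sumrN -addrA.
congr (_ + _); first by rewrite !subn0 !bin0 exprS; ring.
under [RHS]eq_bigr => j _ do
  rewrite /bump /= !add1n subSS binS natrD mulrDr mulrDl addnS -addSn.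
rewrite [RHS]big_split /=; congr (_ + _).
rewrite [RHS]big_ord_recr /= bin_small // mulr0 mul0r addr0.
apply: eq_bigr => j _; rewrite /bump /= add1n addnS addSn -mulNr -mulNr.
by rewrite -[(t - j)%N](subnSK (ltn_ord j)) exprS mulN1r.
Qed.

Section Subspaces.
Variable F : finFieldType.

(** Forbidding the basis vectors one after the other interpolates between all
    subspaces (t = 0) and [Vtilde] (t = k). *)
Definition avoiding k t : {set {vspace 'rV[F]_k}} :=
  [set U : {vspace 'rV[F]_k} | [forall i : 'I_k, (i < t)%N ==> (delta_mx 0 i \notin U)]].

Lemma avoidingP k t (U : {vspace 'rV[F]_k}) :
  reflect (forall i : 'I_k, (i < t)%N -> delta_mx 0 i \notin U) (U \in avoiding k t).
Proof. by rewrite inE; apply: (iffP forallP) => h i; apply/implyP/h. Qed.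

Lemma Vtilde_avoiding k : Vtilde F k = avoiding k k.
Proof. by apply/setP=> U; rewrite !inE; apply: eq_forallb => i; rewrite ltn_ord. Qed.

Lemma card_avoiding0 k : #|avoiding k 0| = (\sum_(i < k.+1) qbinom F k i)%N.
Proof.
have -> : avoiding k 0 = setT by apply/setP=> U; rewrite in_setT; apply/avoidingP.
rewrite -sum1_card.
rewrite (partition_big (fun U : {vspace 'rV[F]_k} => inord (\dim U) : 'I_k.+1) xpredT) //=.
apply: eq_bigr => i _; rewrite sum1_card /qbinom; apply: eq_card => U.
rewrite !inE unfold_in !inE /= -val_eqE /= inordK // ltnS.
by apply: leq_trans (dimvS (subvf U)) _; rewrite dimvf /dim /= mul1n.
Qed.

(** Deleting coordinate t is a surjection with kernel spanned by e_t, so taking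
    preimages identifies the subspaces in dimension k with the subspaces in
    dimension k + 1 that contain e_t; the vectors e_r with r < t keep their
    indices. *)
Lemma card_avoiding_rec k t : (t <= k)%N ->
  (#|avoiding k.+1 t.+1| + #|avoiding k t| = #|avoiding k.+1 t|)%N.
Proof.
move=> letk; pose o : 'I_k.+1 := inord t.
have oE : o = t :> nat by rewrite inordK.
pose f : 'Hom('rV[F]_k.+1, 'rV[F]_k) := linfun (col' o).
have fE v : f v = col' o v by rewrite lfunE.
have lift_o (i : 'I_k) : (i < t)%N -> lift o i = i :> nat.
  by move=> ltit; rewrite /= /bump oE leqNgt ltit.
have fdelta i : f (delta_mx 0 (lift o i)) = delta_mx 0 i.
  by apply/rowP=> j; rewrite fE !mxE /= (inj_eq lift_inj).
have fdelta0 : f (delta_mx 0 o) = 0.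
  by apply/rowP=> j; rewrite fE !mxE /= eq_sym (negPf (neq_lift _ _)).
have f_ker v : f v = 0 -> v = v 0 o *: delta_mx 0 o.
  rewrite fE => fv0; apply/rowP=> j; rewrite !mxE /=.
  case: (unliftP o j) => [i|] -> /=; last by rewrite eqxx mulr1.
  by have /rowP/(_ i) := fv0; rewrite !mxE eq_sym (negPf (neq_lift _ _)) mulr0.
have f_surj : limg f = fullv.
  apply/vspaceP=> v; rewrite memvf; apply/memv_imgP.
  exists (\sum_i v 0 i *: delta_mx 0 (lift o i)); first exact: memvf.
  rewrite linear_sum /= [LHS]row_sum_delta; apply: eq_bigr => i _.
  by rewrite linearZ /= fdelta.
have fK (U : {vspace 'rV[F]_k}) : (f @: (f @^-1: U) = U)%VS.
  by apply: lpreimK; rewrite f_surj subvf.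
rewrite -(cardsID [set V : {vspace 'rV[F]_k.+1} | delta_mx 0 o \in V] (avoiding k.+1 t)) addnC.
congr (_ + _)%N; last first.
  apply: eq_card => V; rewrite in_setD.
  apply/avoidingP/andP=> [h|[+ /avoidingP h] i]; rewrite in_set; last move=> hV.
    by split; [apply: h; rewrite oE | apply/avoidingP=> i /ltnW/h].
  rewrite ltnS leq_eqVlt => /orP[/eqP eqit|/h//].
  by have -> : i = o by apply: val_inj; rewrite /= eqit oE.
rewrite -(card_imset _ (can_inj fK)); apply: eq_card => V; rewrite in_setI.
apply/imsetP/andP=> [[U /avoidingP avU ->]|[/avoidingP avV +]]; last rewrite in_set => Vo.
  split; last by rewrite in_set -memv_preim fdelta0 mem0v.
  apply/avoidingP=> i ltit; rewrite -memv_preim.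
  case: (unliftP o i) => [j|] eqi; last by move: ltit; rewrite eqi oE ltnn.
  rewrite eqi fdelta avU // -(lift_o j) -?eqi //.
  by move: ltit; rewrite eqi /= /bump oE; case: leqP => //; lia.
have VE : V = (f @^-1: (f @: V))%VS.
  apply/vspaceP=> v; rewrite -memv_preim; apply/idP/memv_imgP=> [vV|[w wV /eqP]].
    by exists v.
  rewrite -subr_eq0 -linearB /= => /eqP/f_ker eqvw.
  by rewrite -(subrK w v) eqvw memvD // memvZ.
exists (f @: V)%VS => //; apply/avoidingP=> i ltit.
by rewrite -fdelta memv_preim -VE avV // lift_o.
Qed.

Lemma card_Vtilde k :
  #|Vtilde F k|%:R = \sum_(j < k.+1)
     (-1) ^+ (k - j) * 'C(k, j)%:R * (\sum_(i < j.+1) qbinom F j i)%N%:R :> rat.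
Proof.
(* Subspaces of dimension k + t, so that the recurrence is a difference in k. *)
pose d t k : rat := #|avoiding (k + t) t|%:R.
have rec t k' : d t.+1 k' = d t k'.+1 - d t k'.
  by rewrite /d addSn -card_avoiding_rec ?leq_addl // natrD addnS addrK.
have := iterated_difference rec k 0; rewrite {1}/d add0n -Vtilde_avoiding => ->.
by apply: eq_bigr => j _; rewrite /d addn0 add0n card_avoiding0.
Qed.

Lemma narayana_Vtilde n k :
  narayana n k.+1 * #|Vtilde F k|%:R =
  \sum_(j < k.+1) \sum_(i < j.+1)
     (-1) ^+ (k - j) / n%:R * 'C(n, k.+1)%:R * 'C(n, k)%:R * 'C(k, j)%:R * (qbinom F j i)%:R.
Proof.
rewrite card_Vtilde mulr_sumr; apply: eq_bigr => j _.
by rewrite natr_sum !mulr_sumr; apply: eq_bigr => i _; rewrite /narayana; ring.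
Qed.
End Subspaces.

(** * Supernormal subgroups and two-sided ideals *)

Section Ideals.
Variables (F : finFieldType) (m : nat).
Implicit Types (X Y Z : 'M[F]_m.+1) (I J : {vspace 'M[F]_m.+1}).
Implicit Types (g h : {'GL_m.+1[F]}) (H : {set {'GL_m.+1[F]}}).
Implicit Types (a : 'I_m.+1 * 'I_m.+1).

(** Over a finite field this turns a set closed under linear combinations into
    a subspace. *)
Lemma mem_span_enum (A : {set 'M[F]_m.+1}) : 0 \in A ->
  (forall c X Y, X \in A -> Y \in A -> c *: X + Y \in A) ->
  forall X, (X \in <<enum A>>%VS) = (X \in A).
Proof.
move=> A0 AP X; apply/idP/idP=> [|XA]; last by rewrite memv_span ?mem_enum.
move=> /(@coord_span _ _ _ (in_tuple (enum A))) ->.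
elim/big_ind: _ => [//|Y Z YA ZA|i _].
  by rewrite -[Y]scale1r AP.
by rewrite -[_ *: _]addr0 AP // -mem_enum mem_nth.
Qed.

Lemma strict_upperP X :
  reflect (forall i j : 'I_m.+1, (j <= i)%N -> X i j = 0) (X \in strict_upper F m).
Proof.
rewrite inE; apply: (iffP forallP) => [h i j ji|h i].
  by have /forallP/(_ j) := h i; rewrite ji => /eqP.
by apply/forallP=> j; apply/implyP=> /h ->.
Qed.

Lemma strict_upper0 : 0 \in strict_upper F m.
Proof. by apply/strict_upperP=> i j _; rewrite mxE. Qed.

Lemma strict_upper_lin c X Y :
  X \in strict_upper F m -> Y \in strict_upper F m -> c *: X + Y \in strict_upper F m.
Proof.
move=> /strict_upperP hX /strict_upperP hY; apply/strict_upperP=> i j ji.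
by rewrite !mxE hX // hY // mulr0 addr0.
Qed.

Lemma strict_upperD X Y :
  X \in strict_upper F m -> Y \in strict_upper F m -> X + Y \in strict_upper F m.
Proof. by move=> hX hY; rewrite -[X]scale1r strict_upper_lin. Qed.

Lemma strict_upperM X Y :
  X \in strict_upper F m -> Y \in strict_upper F m -> X * Y \in strict_upper F m.
Proof.
move=> /strict_upperP hX /strict_upperP hY; apply/strict_upperP=> i j ji.
rewrite mxE big1 // => c _; have [ci|ic] := leqP c i; first by rewrite hX ?mul0r.
by rewrite hY ?mulr0 //; apply: leq_trans (ltnW ic).
Qed.

Lemma strict_upper_delta a : (delta_mx a.1 a.2 \in strict_upper F m) = (a.1 < a.2)%N.
Proof.
apply/strict_upperP/idP=> [h|lta i j ji].
  rewrite ltnNge; apply/negP=> /h/eqP; rewrite mxE !eqxx; exact/negP/oner_neq0.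
rewrite mxE; case: andP => [[/eqP ei /eqP ej]|//].
by move: ji; rewrite ei ej leqNgt lta.
Qed.

Lemma idealP I :
  reflect ((forall Y, Y \in I -> Y \in strict_upper F m) /\
           (forall X Y, X \in strict_upper F m -> Y \in I -> X * Y \in I /\ Y * X \in I))
          (I \in two_sided_ideals F m).
Proof.
rewrite inE; apply: (iffP andP) => -[/= h1 h2]; split.
- by move=> Y; apply/implyP; move/forallP: h1.
- move=> X Y hX hY; apply/andP.
  by move/forall_inP: h2 => /(_ X hX)/forallP/(_ Y); rewrite hY.
- by apply/forallP=> Y; apply/implyP=> /h1.
by apply/forall_inP=> X hX; apply/forallP=> Y; apply/implyP=> /(h2 X _ hX)/andP.
Qed.

Lemma unipotent_exists X : X \in strict_upper F m ->
  exists2 g, g \in unitri F m & GLval g - 1 = X.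
Proof.
move=> hX; have /strict_upperP X0 := hX.
have uX : (1 + X : 'M[F]_m.+1) \is a GRing.unit.
  rewrite -[_ \is a _]/((1 + X) \in unitmx) unitmxE -det_tr det_trig.
    by rewrite big1 ?unitr1 // => i _; rewrite !mxE X0 // eqxx addr0.
  apply/is_trig_mxP => i j ltij; rewrite !mxE X0; last exact: ltnW.
  by rewrite addr0 -val_eqE /= gtn_eqF.
have gX : GLval (FinRing.unit _ uX : {'GL_m.+1[F]}) - 1 = X by rewrite addrC addKr.
by exists (FinRing.unit _ uX : {'GL_m.+1[F]}); rewrite // inE gX.
Qed.

Lemma unitriE g : (g \in unitri F m) = (GLval g - 1 \in strict_upper F m).
Proof. by rewrite inE. Qed.

Lemma GLvalM_sub1 g h : GLval (g * h)%g - 1 =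
  (GLval g - 1) + (GLval h - 1) + (GLval g - 1) * (GLval h - 1).
Proof.
rewrite GL_ME mulrBl mulrBr mulr1 mul1r -addrA [GLval h - 1 + _]addrC subrK.
by rewrite [RHS]addrC subrKA.
Qed.

Definition ideal_group I : {set {'GL_m.+1[F]}} := [set g : {'GL_m.+1[F]} | GLval g - 1 \in I].

Lemma ideal_groupE I g : (g \in ideal_group I) = (GLval g - 1 \in I).
Proof. by rewrite in_set. Qed.

Lemma unitri1 : 1%g \in unitri F m.
Proof. by rewrite unitriE GL_1E subrr strict_upper0. Qed.

Lemma unitriM g h : g \in unitri F m -> h \in unitri F m -> (g * h)%g \in unitri F m.
Proof.
rewrite !unitriE GLvalM_sub1 => hg hh.
by apply: strict_upperD; [exact: strict_upperD|exact: strict_upperM].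
Qed.

Lemma superclassP g h :
  reflect (exists x y, [/\ x \in unitri F m, y \in unitri F m &
              GLval h - 1 = GLval x * (GLval g - 1) * GLval y])
          (h \in superclass g).
Proof.
rewrite inE; apply: (iffP existsP) => [[x /andP[ux /existsP[y /andP[uy /eqP eh]]]]|].
  by exists x, y; rewrite eh addrC addKr.
case=> x [y [ux uy eh]]; exists x; rewrite ux; apply/existsP; exists y.
by rewrite uy -eh addrC subrK eqxx.
Qed.

Lemma superclass_refl g : g \in superclass g.
Proof. by apply/superclassP; exists 1%g, 1%g; rewrite unitri1 GL_1E mul1r mulr1. Qed.

Lemma superclass_trans g h k : h \in superclass g -> k \in superclass h -> k \in superclass g.
Proof.
case/superclassP=> x [y [ux uy eh]] /superclassP[x' [y' [ux' uy' ek]]].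
apply/superclassP; exists (x' * x)%g, (y * y')%g; rewrite !unitriM //.
by rewrite ek eh !GL_ME !mulrA.
Qed.

(** Superclasses partition the unitriangular group, so a union of superclasses
    is a set closed under passing to the superclass of an element. *)
Lemma supernormalP H :
  reflect [/\ group_set H, H \subset unitri F m &
             forall g h, g \in H -> h \in superclass g -> h \in H]
          (H \in supernormal_subgroups F m).
Proof.
rewrite inE; apply: (iffP and3P) => -[gH sH hK]; split=> //.
  case/existsP: hK => K /andP[/subsetP sK /eqP ->] g h /bigcupP[C KC gC] hg.
  have /imsetP[g0 _ eC] := sK C KC; apply/bigcupP; exists C => //.
  by rewrite eC in gC *; exact: superclass_trans hg.
apply/existsP; exists [set superclass g | g in H]; apply/andP; split.
  by apply/subsetP=> _ /imsetP[g gH' ->]; apply: imset_f; apply: (subsetP sH).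
rewrite eqEsubset; apply/andP; split; apply/subsetP=> g.
  by move=> gH'; apply/bigcupP; exists (superclass g); rewrite ?imset_f ?superclass_refl.
by case/bigcupP=> _ /imsetP[h hH ->]; exact: hK.
Qed.

Lemma ideal_group_supernormal I :
  I \in two_sided_ideals F m -> ideal_group I \in supernormal_subgroups F m.
Proof.
case/idealP=> sI mI; apply/supernormalP; split.
- apply/group_setP; split=> [|g h]; rewrite !ideal_groupE ?GL_1E ?subrr ?mem0v //.
  move=> gI hI; have [ghI _] := mI _ _ (sI _ gI) hI.
  by rewrite GLvalM_sub1; apply: memvD => //; exact: memvD.
- by apply/subsetP=> g; rewrite ideal_groupE unitriE; exact: sI.
move=> g h + /superclassP[x [y [ux uy eh]]]; rewrite !ideal_groupE eh => gI.
rewrite unitriE in ux; rewrite unitriE in uy.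
have xgI : GLval x * (GLval g - 1) \in I.
  rewrite -[GLval x](subrK 1) mulrDl mul1r memvD //.
  by have [] := mI _ _ ux gI.
rewrite -[GLval y](subrK 1) mulrDr mulr1 memvD //.
by have [] := mI _ _ uy xgI.
Qed.

(** Every element of an ideal is g - 1 for some unipotent g. *)
Lemma ideal_group_inj : {in two_sided_ideals F m &, injective (@ideal_group)}.
Proof.
have sub I J : I \in two_sided_ideals F m -> ideal_group I = ideal_group J -> {subset I <= J}.
  case/idealP=> sI _ eqIJ X XI; have [g _ gX] := unipotent_exists (sI X XI).
  by rewrite -gX -ideal_groupE -eqIJ ideal_groupE gX.
move=> I J hI hJ eqIJ; apply/vspaceP=> X.
by apply/idP/idP; apply: sub.
Qed.

(** The additive group has prime order, so 1 generates it. *)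
Lemma prime_field_natr : prime #|F| -> forall c : F, exists k, c = k%:R.
Proof.
move=> prF c; suff : c \in <[(1 : F)%R]>%g.
  by case/cycleP=> k ->; exists k; rewrite FinRing.zmodXgE.
have nt1 : #[(1 : F)%R]%g != 1%N by rewrite order_eq1 FinRing.zmod1gE oner_eq0.
have o1 : #|<[(1 : F)%R]>%g| = #|F|.
  by apply/(prime_nt_dvdP prF nt1); rewrite -cardsT; exact: cardSg (subsetT _).
have /eqP -> : <[(1 : F)%R]>%g == [set: F]; last by rewrite inE.
by rewrite eqEcard subsetT o1 cardsT /=.
Qed.

(** Only the closure of H - 1 under scalars depends on the field being prime:
    scalar multiples are then iterated sums. *)
Lemma supernormal_ideal H : prime #|F| -> H \in supernormal_subgroups F m ->
  exists2 I, I \in two_sided_ideals F m & ideal_group I = H.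
Proof.
move=> prF /supernormalP[/group_setP[H1 HM] /subsetP sH cH].
pose A := [set X : 'M[F]_m.+1 | [exists g in H, GLval g - 1 == X]].
have AP X : reflect (exists2 g, g \in H & GLval g - 1 = X) (X \in A).
  by rewrite inE; apply: (iffP exists_inP) => -[g gH /eqP eX]; exists g => //; exact/eqP.
have sA X : X \in A -> X \in strict_upper F m.
  by case/AP=> g /sH; rewrite unitriE => ? <-.
have A0 : 0 \in A by apply/AP; exists 1%g; rewrite // GL_1E subrr.
have AU x X y : x \in unitri F m -> y \in unitri F m -> X \in A -> GLval x * X * GLval y \in A.
  move=> ux uy /AP[g gH <-].
  have [h _ eh] : exists2 h, h \in unitri F m & GLval h - 1 = GLval x * (GLval g - 1) * GLval y.
    apply: unipotent_exists; have := sH g gH; rewrite unitriE => sg.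
    have sx : GLval x * (GLval g - 1) \in strict_upper F m.
      rewrite -[GLval x](subrK 1) mulrDl mul1r strict_upperD //.
      by rewrite strict_upperM // -unitriE.
    rewrite -[GLval y](subrK 1) mulrDr mulr1 strict_upperD //.
    by rewrite strict_upperM // -unitriE.
  by apply/AP; exists h => //; apply: (cH g) => //; apply/superclassP; exists x, y.
have AV g : g \in H -> (g^-1)%g \in unitri F m.
  move=> gH; suff : (g^-1)%g \in H by exact: sH.
  by have := groupVr (G := group (introT group_setP (conj H1 HM))) gH.
have AD X Y : X \in A -> Y \in A -> X + Y \in A.
  case/AP=> g gH <- YA.
  (* h = 1 + g^-1 Y is in the superclass of 1 + Y, and g h - 1 = (g - 1) + Y. *)
  have /AP[h hH eh] := AU _ _ _ (AV g gH) unitri1 YA.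
  apply/AP; exists (g * h)%g; first exact: HM.
  rewrite GLvalM_sub1 eh GL_1E mulr1 -addrA -[X in X + _ * _]mul1r -mulrDl.
  by rewrite [1 + _]addrC subrK mulrA -GL_ME mulgV mul1r.
have AZ c X : X \in A -> c *: X \in A.
  have [k ->] := prime_field_natr prF c; move=> XA; rewrite scaler_nat.
  by elim: k => [|k IHk]; rewrite ?mulr0n // mulrS AD.
have AB X Y : X \in A -> Y \in A -> X - Y \in A.
  by move=> XA YA; rewrite AD // -scaleN1r AZ.
have memI := mem_span_enum A0 (fun c X Y XA YA => AD _ _ (AZ c X XA) YA).
exists <<enum A>>%VS.
  apply/idealP; split=> [Y|X Y sX]; first by rewrite memI; exact: sA.
  have [x ux <-] := unipotent_exists sX; rewrite !memI => YA.
  split; rewrite ?mulrBl ?mulrBr ?mul1r ?mulr1 AB //.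
    by have := AU _ _ _ ux unitri1 YA; rewrite GL_1E mulr1.
  by have := AU _ _ _ unitri1 ux YA; rewrite GL_1E mul1r.
apply/setP=> g; rewrite ideal_groupE memI; apply/AP/idP => [[h hH /addIr/val_inj <-] //|gH].
by exists g.
Qed.

End Ideals.

(** * The ideal attached to an antichain and a subspace *)

Section Pattern.
Variables (F : finFieldType) (m : nat).
Implicit Types (X Y Z : 'M[F]_m.+1) (I J : {vspace 'M[F]_m.+1}).
Implicit Types (a b s : 'I_m.+1 * 'I_m.+1) (S : {set 'I_m.+1 * 'I_m.+1}).

(** The position read off by coordinate r of [phi]. What matters below is that
    r |-> slot r is a bijection onto S, whatever the order. *)
Definition slot S (r : 'I_#|S|) : 'I_m.+1 * 'I_m.+1 := nth (0, 0) (enum_by_row S) r.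

Lemma size_enum_by_row S : size (enum_by_row S) = #|S|.
Proof. by rewrite size_sort -cardE. Qed.

Lemma mem_enum_by_row S a : (a \in enum_by_row S) = (a \in S).
Proof. by rewrite mem_sort mem_enum. Qed.

Lemma slot_mem S (r : 'I_#|S|) : slot r \in S.
Proof. by rewrite -mem_enum_by_row mem_nth // size_enum_by_row. Qed.

Lemma slot_inj S : injective (@slot S).
Proof.
move=> r r' /eqP; rewrite nth_uniq ?size_enum_by_row ?sort_uniq ?enum_uniq //.
by move/eqP/val_inj.
Qed.

Lemma slot_surj S s : s \in S -> exists r : 'I_#|S|, slot r = s.
Proof.
move=> sS; have lt : (index s (enum_by_row S) < #|S|)%N.
  by rewrite -size_enum_by_row index_mem mem_enum_by_row.
by exists (Ordinal lt); rewrite /slot nth_index // mem_enum_by_row.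
Qed.

Lemma phiE S X (r : 'I_#|S|) : phi S X 0 r = X (slot r).1 (slot r).2.
Proof. by rewrite mxE. Qed.

Fact phi_is_linear S : linear (@phi F m S).
Proof. by move=> c X Y; apply/rowP=> r; rewrite phiE !mxE. Qed.

HB.instance Definition _ S :=
  GRing.isLinear.Build F 'M[F]_m.+1 'rV[F]_#|S| _ (phi S) (@phi_is_linear S).

Lemma phi_eq0 S X : (forall s, s \in S -> X s.1 s.2 = 0) -> phi S X = 0.
Proof. by move=> X0; apply/rowP=> r; rewrite phiE mxE X0 // slot_mem. Qed.

Lemma phi_delta S (r : 'I_#|S|) :
  phi S (delta_mx (slot r).1 (slot r).2) = delta_mx 0 r :> 'rV[F]_#|S|.
Proof.
apply/rowP=> r'; rewrite phiE !mxE /= -(inj_eq (@slot_inj S)).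
by rewrite -pair_eqE.
Qed.

Lemma prec_le_trans a b s : prec a b -> prec_eq b s -> prec a s.
Proof.
rewrite /prec /prec_eq => /andP[+ ab] bs; rewrite -!pair_eqE /= -!val_eqE /= => neq.
lia.
Qed.

Definition in_pattern S (U : {vspace 'rV[F]_#|S|}) X :=
  [&& X \in strict_upper F m, phi S X \in U &
      [forall a in upper_pairs m, [exists b in S, prec a b] ==> (X a.1 a.2 == 0)]].

Definition pattern S (U : {vspace 'rV[F]_#|S|}) : {vspace 'M[F]_m.+1} :=
  <<enum [set X | in_pattern U X]>>%VS.

Lemma in_patternP S (U : {vspace 'rV[F]_#|S|}) X :
  reflect [/\ X \in strict_upper F m, phi S X \in U &
             forall a b, b \in S -> prec a b -> X a.1 a.2 = 0] (in_pattern U X).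
Proof.
apply: (iffP and3P) => -[sX UX X0]; split=> //.
  move=> a b bS ab; have /strict_upperP sX' := sX.
  have [/sX' //|lta] := leqP a.2 a.1.
  move/forall_inP: X0 => /(_ a); rewrite inE => /(_ lta)/implyP H; apply/eqP/H.
  by apply/exists_inP; exists b.
apply/forall_inP=> a _; apply/implyP=> /exists_inP[b bS ab].
by apply/eqP/(X0 a b).
Qed.

Lemma patternP S (U : {vspace 'rV[F]_#|S|}) X :
  reflect [/\ X \in strict_upper F m, phi S X \in U &
             forall a b, b \in S -> prec a b -> X a.1 a.2 = 0] (X \in pattern U).
Proof.
have E Y : (Y \in [set X | in_pattern U X]) = in_pattern U Y by rewrite in_set.
rewrite mem_span_enum; first by rewrite E; exact: in_patternP.
  rewrite E; apply/in_patternP; rewrite linear0 mem0v strict_upper0.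
  by split=> // a b _ _; rewrite mxE.
move=> c Y Z; rewrite !E => /in_patternP[sY UY Y0] /in_patternP[sZ UZ Z0].
apply/in_patternP; split=> [||a b bS ab]; first exact: strict_upper_lin.
  by rewrite linearP memvD // memvZ.
by rewrite !mxE (Y0 a b) // (Z0 a b) // mulr0 addr0.
Qed.

Lemma Gn_pattern S (U : {vspace 'rV[F]_#|S|}) : Gn U = ideal_group (pattern U).
Proof.
apply/setP=> g; rewrite ideal_groupE; apply/setIdP/patternP=> /=.
  by case=> + gU; rewrite unitriE => sg; apply/in_patternP; rewrite /in_pattern sg.
by rewrite unitriE => /in_patternP/and3P[-> -> ->].
Qed.

(** If (i, j) lies weakly below s in S and X, Y are strictly upper triangular,
    the entry of X Y at (i, j) only involves entries of Y at (c, j) with i < c,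
    which are strictly below s. So products vanish on S as well as below it. *)
Lemma pattern_ideal S (U : {vspace 'rV[F]_#|S|}) : pattern U \in two_sided_ideals F m.
Proof.
apply/idealP; split=> [X /patternP[]//|X Y sX /patternP[sY _ Y0]].
have /strict_upperP X0 := sX.
have XY0 a b : b \in S -> prec_eq a b -> (X * Y) a.1 a.2 = 0.
  move=> bS ab; rewrite mxE big1 // => c _.
  have [ca|ac] := leqP c a.1; first by rewrite X0 ?mul0r.
  rewrite (Y0 (c, a.2) b) ?mulr0 // /prec -pair_eqE /= -val_eqE /=.
  by move: ab; rewrite /prec_eq /=; lia.
have YX0 a b : b \in S -> prec_eq a b -> (Y * X) a.1 a.2 = 0.
  move=> bS ab; rewrite mxE big1 // => c _.
  have [ac|ca] := leqP a.2 c; first by rewrite X0 ?mulr0.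
  rewrite (Y0 (a.1, c) b) ?mul0r // /prec -pair_eqE /= -!val_eqE /=.
  by move: ab; rewrite /prec_eq /=; lia.
have eqS b : prec_eq b b by rewrite /prec_eq !leqnn.
split; apply/patternP; split; try exact: strict_upperM.
- by rewrite phi_eq0 ?mem0v // => s sS; apply: XY0 (eqS s).
- by move=> a b bS /andP[_ ab]; apply: XY0 ab.
- by rewrite phi_eq0 ?mem0v // => s sS; apply: YX0 (eqS s).
by move=> a b bS /andP[_ ab]; apply: YX0 ab.
Qed.

(** This is the inverse construction: the antichain S of an ideal I, read off
    as in [corners_pattern] from the elementary matrices missing from I. *)
Definition corners I : {set 'I_m.+1 * 'I_m.+1} :=
  [set a in upper_pairs m | (delta_mx a.1 a.2 \notin I) &&
     [forall b, prec a b ==> (delta_mx b.1 b.2 \in I)]].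

Lemma cornersP I a :
  reflect [/\ (a.1 < a.2)%N, delta_mx a.1 a.2 \notin I &
             forall b, prec a b -> delta_mx b.1 b.2 \in I] (a \in corners I).
Proof.
rewrite inE inE; apply: (iffP and3P) => -[lta aI h]; split=> //.
  by move=> b; apply/implyP; move/forallP: h.
by apply/forallP=> b; apply/implyP/h.
Qed.

(** At a position s of S the elementary matrix is excluded because its image
    under [phi] is a standard basis vector, hence not in U. *)
Lemma delta_pattern S (U : {vspace 'rV[F]_#|S|}) a :
  antichain S -> U \in Vtilde F #|S| -> (a.1 < a.2)%N ->
  (delta_mx a.1 a.2 \in pattern U) = [forall s in S, ~~ prec_eq a s].
Proof.
move=> /antichainP[_ anti] /[!inE] /forallP VU lta.
apply/idP/forall_inP=> [/patternP[_ aU a0] s sS|na].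
  apply/negP=> as_; have [eqas|neq] := eqVneq a s.
    have [r er] := slot_surj sS; have /negP := VU r; apply.
    by rewrite -phi_delta er -eqas.
  have := a0 a s sS; rewrite /prec neq as_ => /(_ isT)/eqP.
  by rewrite mxE !eqxx oner_eq0.
have d0 b s : s \in S -> prec_eq b s -> delta_mx a.1 a.2 b.1 b.2 = 0 :> F.
  move=> sS bs; rewrite mxE; case: andP => // -[/eqP e1 /eqP e2].
  have eqba : b = a by apply/eqP; rewrite -pair_eqE /= e1 e2 !eqxx.
  by have /negP := na s sS; rewrite -eqba bs.
apply/patternP; split; first by rewrite strict_upper_delta.
  rewrite phi_eq0 ?mem0v // => s sS; apply: (d0 s s) => //.
  by rewrite /prec_eq !leqnn.
by move=> b s sS /andP[_ bs]; apply: d0 bs.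
Qed.

Lemma prec_eq_anti a b : prec_eq a b -> prec_eq b a -> a = b.
Proof.
rewrite /prec_eq => ab ba; apply/eqP; rewrite -pair_eqE /= -!val_eqE /=; lia.
Qed.

Lemma prec_upper a b : (a.1 < a.2)%N -> prec a b -> (b.1 < b.2)%N.
Proof. by rewrite /prec /prec_eq => lta /andP[_]; lia. Qed.

(** By [delta_pattern] the elementary matrices missing from the ideal are those
    weakly below S, and the maximal ones among these positions form S. *)
Lemma corners_pattern S (U : {vspace 'rV[F]_#|S|}) :
  antichain S -> U \in Vtilde F #|S| -> corners (pattern U) = S.
Proof.
move=> aS VU; have /antichainP[Sup anti] := aS.
have refl b : prec_eq b b by rewrite /prec_eq !leqnn.
apply/setP=> a; apply/cornersP/idP=> [[lta]|sS].
  rewrite delta_pattern // => /forall_inPn[s sS /negPn as_] h.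
  have [-> //|neq] := eqVneq a s.
  have := h s; rewrite /prec neq as_ delta_pattern ?Sup // => /(_ isT)/forall_inP/(_ s sS).
  by rewrite refl.
have lta := Sup a sS; rewrite delta_pattern //; split=> // [|b ab].
  by apply/forall_inPn; exists a; rewrite ?refl.
rewrite delta_pattern ?(prec_upper lta ab) //; apply/forall_inP=> s sS'.
apply/negP=> bs; have eqas : a = s.
  by apply: anti => //; case/andP: (prec_le_trans ab bs).
case/andP: ab => /eqP neq ab; case: neq.
by apply: prec_eq_anti => //; rewrite eqas.
Qed.

(** A vector u is in U exactly when the ideal contains the matrix having the
    coordinates of u as its entries on S and zeros elsewhere. *)
Lemma pattern_inj S (U U' : {vspace 'rV[F]_#|S|}) :
  antichain S -> pattern U = pattern U' -> U = U'.
Proof.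
move=> /antichainP[Sup anti] eqU.
suff Uphi (V : {vspace 'rV[F]_#|S|}) u : (u \in V) =
    (\sum_r u 0 r *: delta_mx (slot r).1 (slot r).2 \in pattern V).
  by apply/vspaceP=> u; rewrite !Uphi eqU.
set X := \sum_r _; have phiX : phi S X = u.
  rewrite linear_sum /= [RHS]row_sum_delta; apply: eq_bigr => r _.
  by rewrite linearZ /= phi_delta.
apply/idP/patternP=> [Vu|[_]]; last by rewrite phiX.
have X0 a : a \notin S -> X a.1 a.2 = 0.
  move=> aS; rewrite summxE big1 // => r _; rewrite !mxE.
  case: andP => [[/eqP e1 /eqP e2]|]; last by rewrite mulr0.
  have er : a = slot r by apply/eqP; rewrite -pair_eqE /= e1 e2 !eqxx.
  by rewrite er slot_mem in aS.
rewrite phiX; split=> //.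
  apply/strict_upperP=> i j ji; apply: (X0 (i, j)); apply/negP=> /Sup /=.
  by rewrite ltnNge ji.
move=> a b bS /andP[neq ab]; apply: X0; apply/negP=> aS.
by case/eqP: neq; exact: anti.
Qed.

End Pattern.

(** * Every ideal comes from a pair *)

Section IdealPattern.
Variables (F : finFieldType) (m : nat).
Implicit Types (X Y Z : 'M[F]_m.+1) (I J : {vspace 'M[F]_m.+1}).
Implicit Types (a b s : 'I_m.+1 * 'I_m.+1) (S : {set 'I_m.+1 * 'I_m.+1}).
Implicit Types (i j c r : 'I_m.+1).

Lemma delta_mulmx X i j : delta_mx i j *m X = \sum_c X j c *: delta_mx i c.
Proof.
apply/matrixP=> r c; rewrite !mxE summxE (bigD1 j) //= big1 => [|k /negPf nk].
  rewrite (bigD1 c) //= big1 => [|k /negPf nk]; last by rewrite !mxE [c == k]eq_sym nk andbF mulr0.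
  by rewrite !mxE !eqxx !andbT !addr0 mulrC.
by rewrite mxE nk andbF mul0r.
Qed.

Lemma mulmx_delta X i j : X *m delta_mx i j = \sum_r X r i *: delta_mx r j.
Proof.
apply/matrixP=> r c; rewrite !mxE summxE (bigD1 i) //= big1 => [|k /negPf nk].
  rewrite (bigD1 r) //= big1 => [|k /negPf nk]; last by rewrite !mxE [r == k]eq_sym nk mulr0.
  by rewrite !mxE !eqxx /= !addr0.
by rewrite mxE nk mulr0.
Qed.

Lemma delta_mulmx_delta X r i j c :
  delta_mx r i *m X *m delta_mx j c = X i j *: delta_mx r c.
Proof.
rewrite delta_mulmx mulmx_suml (bigD1 j) //= big1 => [|k nk].
  by rewrite -scalemxAl mul_delta_mx addr0.
by rewrite -scalemxAl mul_delta_mx_0 ?scaler0.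
Qed.

Section OneIdeal.
Variable I : {vspace 'M[F]_m.+1}.
Hypothesis idealI : I \in two_sided_ideals F m.

Lemma ideal_deltal X r i : X \in I -> (r < i)%N -> delta_mx r i *m X \in I.
Proof.
case/idealP: idealI => _ mI XI ri.
by have [] := mI (delta_mx r i) X _ XI; first by rewrite (strict_upper_delta F (r, i)).
Qed.

Lemma ideal_deltar X j c : X \in I -> (j < c)%N -> X *m delta_mx j c \in I.
Proof.
case/idealP: idealI => _ mI XI jc.
by have [] := mI (delta_mx j c) X _ XI; first by rewrite (strict_upper_delta F (j, c)).
Qed.

Lemma ideal_scale X k : k != 0 -> k *: X \in I -> X \in I.
Proof. by move=> k0 kX; rewrite -[X]scale1r -(mulVf k0) -scalerA memvZ. Qed.

Lemma ideal_delta_inner X i j r c :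
  X \in I -> X i j != 0 -> (r < i)%N -> (j < c)%N -> delta_mx r c \in I.
Proof.
move=> XI Xij ri jc; apply: (ideal_scale Xij).
by rewrite -delta_mulmx_delta ideal_deltar ?ideal_deltal.
Qed.

(** If row i of X has a nonzero entry left of j, then [ideal_delta_inner]
    applies to it. Otherwise moving row i of X to row r gives X_ij e_rj plus
    multiples of matrices e_rc with c > j, which are in I by
    [ideal_delta_inner]. *)
Lemma ideal_delta_row X i j r : X \in I -> X i j != 0 -> (r < i)%N -> delta_mx r j \in I.
Proof.
move=> XI Xij ri; apply: (ideal_scale Xij).
have [/existsP[c /andP[cj Xic]]|/existsPn noc] :=
  boolP [exists c : 'I_m.+1, (c < j)%N && (X i c != 0)].
  by rewrite memvZ // (ideal_delta_inner XI Xic).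
rewrite -[_ *: _](addrK (\sum_(c | c != j) X i c *: delta_mx r c)) memvB //.
  by have := ideal_deltal XI ri; rewrite delta_mulmx (bigD1 j).
apply: memv_suml => c cj; have [ltcj|ltjc] : (c < j \/ j < c)%N.
- by apply/orP; rewrite -neq_ltn.
- by have := noc c; rewrite ltcj negbK => /eqP->; rewrite scale0r mem0v.
by rewrite memvZ // (ideal_delta_inner XI Xij).
Qed.

(** The transpose of the argument for [ideal_delta_row]. *)
Lemma ideal_delta_col X i j c : X \in I -> X i j != 0 -> (j < c)%N -> delta_mx i c \in I.
Proof.
move=> XI Xij jc; apply: (ideal_scale Xij).
have [/existsP[r /andP[ir Xrj]]|/existsPn nor] :=
  boolP [exists r : 'I_m.+1, (i < r)%N && (X r j != 0)].
  by rewrite memvZ // (ideal_delta_inner XI Xrj).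
rewrite -[_ *: _](addrK (\sum_(r | r != i) X r j *: delta_mx r c)) memvB //.
  by have := ideal_deltar XI jc; rewrite mulmx_delta (bigD1 i).
apply: memv_suml => r ri; have [ltri|ltir] : (r < i \/ i < r)%N.
- by apply/orP; rewrite -neq_ltn.
- by rewrite memvZ // (ideal_delta_inner XI Xij).
by have := nor r; rewrite ltir negbK => /eqP->; rewrite scale0r mem0v.
Qed.

(** A position strictly above a is reached by moving up, right, or both. *)
Lemma ideal_delta_above X a b :
  X \in I -> X a.1 a.2 != 0 -> prec a b -> delta_mx b.1 b.2 \in I.
Proof.
case: a b => [i j] [r c] XI Xij /andP[neq]; rewrite /prec_eq /= => /andP[ri jc].
have [ltri|leir] := ltnP r i.
  have [ltjc|lecj] := ltnP j c; first exact: ideal_delta_inner Xij _ _.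
  have -> : c = j by apply/val_inj/eqP; rewrite eqn_leq lecj.
  exact: ideal_delta_row Xij _.
have eir : i = r by apply/val_inj/eqP; rewrite eqn_leq ri leir.
rewrite -eir; apply: ideal_delta_col Xij _ => //.
rewrite ltn_neqAle jc andbT; apply: contraNneq neq => ejc.
by rewrite eir; apply/eqP; congr (_, _); apply: val_inj.
Qed.

(** Take a position above a, with elementary matrix not in I, that is as far as
    possible from the diagonal. *)
Lemma below_corner a :
  (a.1 < a.2)%N -> delta_mx a.1 a.2 \notin I -> exists2 s, s \in corners I & prec_eq a s.
Proof.
pose P b := prec_eq a b && (delta_mx b.1 b.2 \notin I).
move=> lta aI; have Pa : P a by rewrite /P aI /prec_eq !leqnn.
case: (arg_maxnP (fun b => b.2 - b.1)%N Pa) => s /andP[as_ sI] smax.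
exists s => //; apply/cornersP; split=> //; first by move: as_; rewrite /prec_eq; lia.
move=> b sb; apply: contraT => bI.
have ab : prec_eq a b by move: as_ sb; rewrite /prec /prec_eq => ? /andP[_]; lia.
have := smax b; rewrite /P ab bI => /(_ isT).
case/andP: sb; rewrite /prec_eq -pair_eqE /= -!val_eqE /=.
by move: ab as_; rewrite /prec_eq; lia.
Qed.

Lemma corners_antichain : antichain (corners I).
Proof.
apply/antichainP; split=> [a /cornersP[]//|a b /cornersP[_ _ aI] /cornersP[_ bI _] ab].
by apply: contraNeq bI => neq; apply: aI; rewrite /prec neq.
Qed.

(** By [below_corner] the nonzero entries of Z sit at positions whose elementary matrix
    is in I. *)
Lemma ideal_mem_above Z : Z \in strict_upper F m ->
  (forall a s, s \in corners I -> prec_eq a s -> Z a.1 a.2 = 0) -> Z \in I.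
Proof.
move=> /strict_upperP sZ Z0; rewrite [Z]matrix_sum_delta.
apply: memv_suml => i _; apply: memv_suml => j _.
have [ji|ij] := leqP j i; first by rewrite sZ // scale0r mem0v.
have [dI|dI] := boolP (delta_mx i j \in I); first by rewrite memvZ.
have [s sS as_] := below_corner (a := (i, j)) ij dI.
by rewrite (Z0 (i, j) s) // scale0r mem0v.
Qed.

Let S := corners I.
Let U : {vspace 'rV[F]_#|S|} := (linfun (@phi F m S) @: I)%VS.

Lemma ideal_zero_below X a s : X \in I -> s \in S -> prec a s -> X a.1 a.2 = 0.
Proof.
move=> XI /cornersP[_ sI _] as_; apply: contraNeq sI => Xa.
exact (ideal_delta_above XI Xa as_).
Qed.

(** The difference X - Y vanishes weakly below every corner, hence is a
    combination of elementary matrices of I. *)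
Lemma ideal_mem_phi X Y : X \in strict_upper F m ->
  (forall a s, s \in S -> prec a s -> X a.1 a.2 = 0) ->
  Y \in I -> phi S X = phi S Y -> X \in I.
Proof.
move=> sX X0 YI phiXY; rewrite -[X](subrK Y) memvD // ideal_mem_above //.
  rewrite -[X]scale1r addrC -scaleN1r strict_upper_lin // ?scale1r //.
  by case/idealP: idealI => sI _; exact: sI.
move=> a s sS as_; rewrite !mxE; have [eqas|neq] := eqVneq a s.
  have [r er] := slot_surj sS.
  by have /rowP/(_ r) := phiXY; rewrite !phiE er eqas => ->; rewrite subrr.
have ps : prec a s by rewrite /prec neq.
by rewrite (X0 a s) // (ideal_zero_below YI sS ps) subr0.
Qed.

(** If e_r = phi Y with Y in I, then [ideal_mem_phi] puts the elementary matrix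
    at the corner [slot r] into I. *)
Lemma ideal_Vtilde : U \in Vtilde F #|S|.
Proof.
rewrite inE; apply/forallP=> r; apply/negP=> /memv_imgP[Y YI].
rewrite lfunE /= -phi_delta => eqY.
have := slot_mem r; case/cornersP=> lts /negP sI _; apply: sI.
apply: ideal_mem_phi YI eqY; first by rewrite strict_upper_delta.
move=> a s sS; rewrite mxE; case: andP => // -[/eqP e1 /eqP e2].
have -> : a = slot r by apply/eqP; rewrite -pair_eqE /= e1 e2 !eqxx.
case/andP=> /eqP neq rs; case: neq.
by have /antichainP[_] := corners_antichain; apply=> //; exact: slot_mem.
Qed.

Lemma ideal_pattern : pattern U = I.
Proof.
apply/vspaceP=> X; apply/patternP/idP => [[sX /memv_imgP[Y YI]]|XI].
  by rewrite lfunE /= => eqY X0; exact: ideal_mem_phi YI eqY.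
split; first by case/idealP: idealI => sI _; exact: sI.
  by rewrite -[phi S X]lfunE memv_img.
by move=> a s; exact: ideal_zero_below.
Qed.

End OneIdeal.

(** * The bijection and the count *)

Definition pair_pattern (SU : pair_type F m) : {vspace 'M[F]_m.+1} := pattern (tagged SU).

Lemma antichain_pairP (SU : pair_type F m) :
  reflect (antichain (tag SU) /\ tagged SU \in Vtilde F #|tag SU|)
          (SU \in antichain_pairs F m).
Proof. by rewrite [SU \in _]in_set; exact: andP. Qed.

Lemma pair_pattern_inj : {in antichain_pairs F m &, injective pair_pattern}.
Proof.
move=> [S U] [S' U'] /antichain_pairP[/= aS VU] /antichain_pairP[/= aS' VU'] eqI.
rewrite /pair_pattern /= in eqI.
have eqS : S = S' by rewrite -(corners_pattern aS VU) eqI corners_pattern.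
clear VU' aS'; case: S' / eqS in U' eqI *.
by rewrite (pattern_inj aS eqI).
Qed.

Lemma pair_pattern_image : pair_pattern @: antichain_pairs F m = two_sided_ideals F m.
Proof.
apply/setP=> I; apply/imsetP/idP => [[SU _ ->]|iI]; first exact: pattern_ideal.
exists (Tagged (fun S => {vspace 'rV[F]_#|S|}) (linfun (@phi F m (corners I)) @: I)%VS).
  by apply/antichain_pairP; split; [exact: corners_antichain|exact: ideal_Vtilde].
by rewrite /pair_pattern /= ideal_pattern.
Qed.

Lemma Gmap_pattern SU : Gmap SU = ideal_group (pair_pattern SU).
Proof. exact: Gn_pattern. Qed.

Lemma card_antichain_pairs :
  #|antichain_pairs F m|%:R = \sum_(k < m.+1) narayana m.+1 k.+1 * #|Vtilde F k|%:R :> rat.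
Proof.
have -> : #|antichain_pairs F m| =
    (\sum_(S : {set 'I_m.+1 * 'I_m.+1} | antichain S) #|Vtilde F #|S| |)%N.
  under [RHS]eq_bigr => S _ do rewrite -sum1_card.
  rewrite sig_big_dep -sum1_card; apply: eq_bigl => SU.
  exact/antichain_pairP/andP.
rewrite (partition_big (fun S => inord #|S| : 'I_m.+1) xpredT) //= natr_sum.
apply: eq_bigr => k _.
rewrite (eq_bigr (fun=> #|Vtilde F k|)) => [|S /andP[aS /eqP <-]]; last first.
  by rewrite inordK // ltnS card_antichain_le.
rewrite sum_nat_const natrM; congr (_ * _).
have n0 : (m.+1)%:R != 0 :> rat by rewrite Num.Theory.pnatr_eq0.
apply: (mulfI n0); rewrite /narayana -[_ * _ * _]mulrA mulVKf // -!natrM -card_antichains.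
congr (_ * _)%:R; apply: eq_card => S; rewrite inE unfold_in.
case aS: (antichain S) => //=.
by rewrite -val_eqE /= inordK // ltnS card_antichain_le.
Qed.

End IdealPattern.

Theorem theorem4p1 (F : finFieldType) (m : nat) (q_prime : prime #|F|) :
  let n := m.+1 in
  [/\ {in antichain_pairs F m &, injective (@Gmap F m)},
      @Gmap F m @: antichain_pairs F m = supernormal_subgroups F m,
      #|supernormal_subgroups F m| = #|two_sided_ideals F m|,
      #|supernormal_subgroups F m|%:R =
        \sum_(k < n) narayana n k.+1 * #|Vtilde F k|%:R :> rat &
      \sum_(k < n) narayana n k.+1 * #|Vtilde F k|%:R =
        \sum_(k < n) \sum_(j < k.+1) \sum_(i < j.+1)
          (-1) ^+ (k - j) / n%:R * 'C(n, k.+1)%:R * 'C(n, k)%:R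
            * 'C(k, j)%:R * (qbinom F j i)%:R :> rat].
Proof.
move=> n.
have pair_ideal SU : SU \in antichain_pairs F m -> pair_pattern SU \in two_sided_ideals F m.
  by move=> SUin; rewrite -pair_pattern_image imset_f.
have Gmap_inj : {in antichain_pairs F m &, injective (@Gmap F m)}.
  move=> SU SU' h h'; rewrite !Gmap_pattern => eqG.
  by apply: pair_pattern_inj => //; apply: ideal_group_inj; rewrite ?pair_ideal.
have ideals_image : @ideal_group F m @: two_sided_ideals F m = supernormal_subgroups F m.
  apply/setP=> H; apply/imsetP/idP => [[I iI ->]|]; first exact: ideal_group_supernormal.
  by case/(supernormal_ideal q_prime) => I iI <-; exists I.
have Gmap_image : @Gmap F m @: antichain_pairs F m = supernormal_subgroups F m.
  rewrite -ideals_image -pair_pattern_image -imset_comp.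
  by apply: eq_imset => SU; exact: Gmap_pattern.
split=> //.
- by rewrite -ideals_image card_in_imset //; exact: ideal_group_inj.
- by rewrite -Gmap_image card_in_imset // card_antichain_pairs.
by apply: eq_bigr => k _; exact: narayana_Vtilde.
Qed.
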